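(* Let $\Gamma$ be a non-elementary geometrically finite Kleinian group containing parabolic elements, with limit set $L(\Gamma)$, set of parabolic fixed points $P$ and standard horoballs $\{H_p\}_{p\in P}$. Let $\lambda\in(1,2]$, $c\geq 1$, $z\in L(\Gamma)$ and $R>0$. If there exists $p_0\in P$ with $$c\,|H_{p_0}|\,R^\lambda\;\geq\;c^2R^{2\lambda}+(|z-p_0|+R)^2,$$ then $$\#\left\{p\in P\cap B(z,R)\;\middle|\;cR^\lambda\leq|H_p|\right\}\leq 1.$$
   Context: Setting: $d\geq 1$; $\mathbb{D}^{d+1}=\{z\in\mathbb{R}^{d+1}: |z|<1\}$ is the Poincaré ball model of hyperbolic space with boundary at infinity $\mathbb{S}^d=\{|z|=1\}$; $\mathbf{0}$ is the origin. $\Gamma$ is a non-elementary geometrically finite (in the sense of Bowditch) Kleinian group acting on $\mathbb{D}^{d+1}$ which contains parabolic elements (elements fixing precisely one point in $\mathbb{S}^d$). $L(\Gamma)=\overline{\Gamma(\mathbf{0})}\setminus\Gamma(\mathbf{0})$ is the limit set and $P\subseteq L(\Gamma)$ is the countable set of parabolic fixed points. Standard horoballs: $\{H_p\}_{p\in P}$ is a fixed family where $H_p$ is a horoball at $p$ (a Euclidean ball with interior contained in $\mathbb{D}^{d+1}$, tangent to $\mathbb{S}^d$ at $p$), such that the horoballs are pairwise disjoint, do not contain $\mathbf{0}$, and $g(H_p)=H_{g(p)}$ for all $g\in\Gamma$, $p\in P$. (Such a family exists.) Notation: $B(z,r)$ is the closed Euclidean ball of centre $z$ and radius $r$; $|X|$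 is the Euclidean diameter of a set $X$, while $|z-p_0|$ is the Euclidean norm. *)

(* Defs.v *)
From mathcomp Require Import all_boot all_order all_algebra.
From mathcomp Require Import all_classical all_reals all_analysis.
Import Order.TTheory GRing.Theory Num.Theory.
Import numFieldNormedType.Exports.

Set Implicit Arguments.
Unset Strict Implicit.
Unset Printing Implicit Defensive.

Local Open Scope classical_set_scope.
Local Open Scope ring_scope.

Section Euclidean.
Context {R : realType} {n : nat}.
Implicit Types (x y a : 'rV[R]_n) (r : R) (A : set 'rV[R]_n).

(* The library norm of a row vector is the sup norm. It induces the Euclidean
   topology, so closure, interior, compact and continuous are the library's;
   lengths are measured with enorm. *)
Definition enorm x : R := Num.sqrt (\sum_(i < n) x ord0 i ^+ 2).

Definition ecball a r : set 'rV[R]_n := [set x | enorm (x - a) <= r].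

Definition ediam A : R :=
  sup [set enorm (xy.1 - xy.2) | xy in A `*` A].

Definition disc : set 'rV[R]_n := [set x | enorm x < 1].
Definition cdisc : set 'rV[R]_n := [set x | enorm x <= 1].
Definition sphere : set 'rV[R]_n := [set x | enorm x = 1].

End Euclidean.

Section Hyperbolic.
Context {R : realType} {d : nat}.
Local Notation V := 'rV[R]_d.+1.
Implicit Types (x y p : V) (g h : V -> V) (Gamma : set (V -> V)).
Implicit Types (A K : set V) (H : V -> set V).

Definition arcosh (t : R) : R := ln (t + Num.sqrt (t ^+ 2 - 1)).

(* The distance of the metric 2|dx| / (1 - |x|^2) on the ball. *)
Definition hdist x y : R :=
  arcosh (1 + 2 * enorm (x - y) ^+ 2 /
                ((1 - enorm x ^+ 2) * (1 - enorm y ^+ 2))).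

(* An isometry of the ball is carried together with its continuous extension
   to the closed ball, which gives the action on the sphere at infinity. The
   values outside the closed ball are irrelevant; they are fixed to those of
   the identity, so that equality of maps is equality of isometries. *)
Definition hyp_isometry g : Prop :=
  [/\ set_bij disc disc g,
      (forall x y, disc x -> disc y -> hdist (g x) (g y) = hdist x y),
      {within cdisc, continuous g} &
      (forall x, ~ cdisc x -> g x = x)].

Definition isometry_group Gamma : Prop :=
  [/\ Gamma `<=` hyp_isometry,
      Gamma id,
      (forall g h, Gamma g -> Gamma h -> Gamma (g \o h)) &
      (forall g, Gamma g -> exists2 h, Gamma h & h \o g = id /\ g \o h = id)].

(* The identity is isolated for uniform convergence on compact subsets of the
   open ball. *)
Definition discrete_group Gamma : Prop :=
  exists K, exists2 e : R,
    0 < e & [/\ compact K, K `<=` disc &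
      forall g, Gamma g -> (forall x, K x -> enorm (g x - x) < e) -> g = id].

Definition kleinian Gamma : Prop :=
  isometry_group Gamma /\ discrete_group Gamma.

Definition orbit0 Gamma : set V := [set g 0 | g in Gamma].

Definition limit_set Gamma : set V := closure (orbit0 Gamma) `\` orbit0 Gamma.

Definition non_elementary Gamma : Prop := ~ (limit_set Gamma #<= `I_2)%card.

Definition parabolic g : Prop := exists! p, sphere p /\ g p = p.

Definition parabolic_points Gamma : set V :=
  [set p | sphere p /\ exists2 g, Gamma g & parabolic g /\ g p = p].

(* Orbit points accumulate at y within bounded hyperbolic distance of the
   geodesic ray from the origin to y. *)
Definition conical_limit_point Gamma y : Prop :=
  limit_set Gamma y /\
  exists C : R, closure [set x | orbit0 Gamma x /\
    exists2 t : R, 0 <= t < 1 & hdist x (t *: y) <= C] y.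

(* The stabiliser of p acts cocompactly on the limit set minus p. *)
Definition bounded_parabolic_point Gamma p : Prop :=
  parabolic_points Gamma p /\
  exists K, [/\ compact K, K `<=` limit_set Gamma `\ p &
    limit_set Gamma `\ p `<=`
      \bigcup_(g in [set g | Gamma g /\ g p = p]) g @` K].

(* Bowditch's condition GF2 (Beardon-Maskit), one of his equivalent
   definitions of geometrical finiteness. *)
Definition geometrically_finite Gamma : Prop :=
  limit_set Gamma `<=`
    conical_limit_point Gamma `|` bounded_parabolic_point Gamma.

Definition horoball_at p A : Prop :=
  exists a, exists2 r : R, 0 < r &
    [/\ A = ecball a r, A° `<=` disc & A `&` sphere = [set p]].

(* H is only constrained at parabolic points. *)
Definition standard_horoballs Gamma H : Prop :=
  let P := parabolic_points Gamma in
  [/\ forall p, P p -> horoball_at p (H p),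
      trivIset P H,
      forall p, P p -> ~ H p 0 &
      forall g p, Gamma g -> P p -> g @` H p = H (g p)].

End Hyperbolic.

(* Main.v *)
(* A horoball of radius r at p has centre (1 - r) p, so horoballs of radii r
   and s at p and q meet as soon as |p - q|^2 <= 4 r s. If p lies in B(z, rho)
   and t := c rho^lambda <= |H_p|, the hypothesis on p0 bounds |p - p0|^2 by
   t |H_{p0}| - t^2 <= |H_p| |H_{p0}|, so H_p meets H_{p0}, and disjointness of
   the standard horoballs leaves only p = p0. *)
Require Import Defs.
From mathcomp Require Import all_boot all_order all_algebra.
From mathcomp Require Import all_classical all_reals all_analysis.
From mathcomp Require Import ring lra.
Import Order.TTheory GRing.Theory Num.Theory.
Import numFieldNormedType.Exports.

Local Open Scope classical_set_scope.
Local Open Scope ring_scope.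

Section Euclidean.
Context {R : realType} {n : nat}.
Implicit Types (x y a b p : 'rV[R]_n) (k r s : R).

Definition dot x y : R := \sum_(i < n) x ord0 i * y ord0 i.

Lemma dotC x y : dot x y = dot y x.
Proof. by apply: eq_bigr => i _; rewrite mulrC. Qed.

Lemma dotDl x y a : dot (x + y) a = dot x a + dot y a.
Proof. by rewrite -big_split; apply: eq_bigr => i _; rewrite mxE mulrDl. Qed.

Lemma dotZl k x a : dot (k *: x) a = k * dot x a.
Proof. by rewrite mulr_sumr; apply: eq_bigr => i _; rewrite mxE mulrA. Qed.

Lemma dotNl x a : dot (- x) a = - dot x a.
Proof. by rewrite -scaleN1r dotZl mulN1r. Qed.

Lemma dotDr x y a : dot a (x + y) = dot a x + dot a y.
Proof. by rewrite !(dotC a) dotDl. Qed.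

Lemma dotZr k x a : dot a (k *: x) = k * dot a x.
Proof. by rewrite !(dotC a) dotZl. Qed.

Lemma dotNr x a : dot a (- x) = - dot a x.
Proof. by rewrite !(dotC a) dotNl. Qed.

(** Expands squared norms by bilinearity, leaving polynomial goals. [dotC] stays out since repeated
    rewriting with it would loop. *)
Definition dotE := (dotDl, dotDr, dotNl, dotNr, dotZl, dotZr).

Lemma dot_ge0 x : 0 <= dot x x.
Proof. by apply: sumr_ge0 => i _; rewrite -expr2 sqr_ge0. Qed.

Lemma dot_eq0 x : dot x x = 0 -> x = 0.
Proof.
move=> /eqP; rewrite psumr_eq0 => [/allP x0|i _]; last by rewrite -expr2 sqr_ge0.
apply/rowP => i; rewrite mxE; apply/eqP.
by have := x0 i (mem_index_enum i); rewrite /= mulf_eq0 orbb.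
Qed.

Lemma enorm_ge0 x : 0 <= enorm x.
Proof. exact: sqrtr_ge0. Qed.

Lemma enorm_sqr x : enorm x ^+ 2 = dot x x.
Proof.
rewrite sqr_sqrtr; last by apply: sumr_ge0 => i _; rewrite sqr_ge0.
by apply: eq_bigr => i _; rewrite expr2.
Qed.

Lemma enorm_le x r : 0 <= r -> (enorm x <= r) = (dot x x <= r ^+ 2).
Proof. by move=> r0; rewrite -enorm_sqr ler_pXn2r// nnegrE enorm_ge0. Qed.

Lemma enormN x : enorm (- x) = enorm x.
Proof. by rewrite /enorm; under eq_bigr do rewrite mxE sqrrN. Qed.

Lemma enormZ k x : 0 <= k -> enorm (k *: x) = k * enorm x.
Proof.
move=> k0; apply: (@pexpIrn _ 2) => //.
- by rewrite nnegrE enorm_ge0.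
- by rewrite nnegrE mulr_ge0// enorm_ge0.
- by rewrite exprMn !enorm_sqr !dotE; ring.
Qed.

(** Cauchy-Schwarz. *)
Lemma dot_le_enorm x y : dot x y <= enorm x * enorm y.
Proof.
have [x0|x0] := eqVneq (enorm x) 0.
  (* Writing the zero vector as [0 *: 0] lets homogeneity evaluate the inner product. *)
  suff -> : x = 0 by rewrite -(scale0r 0) dotZl mul0r mulr_ge0 ?enorm_ge0.
  by apply: dot_eq0; rewrite -enorm_sqr x0 expr0n.
have [y0|y0] := eqVneq (enorm y) 0.
  suff -> : y = 0 by rewrite -(scale0r 0) dotZr mul0r mulr_ge0 ?enorm_ge0.
  by apply: dot_eq0; rewrite -enorm_sqr y0 expr0n.
have xy_gt0 : 0 < enorm x * enorm y.
  by rewrite mulr_gt0// lt0r enorm_ge0 ?x0 ?y0.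
(* This square equals 2 |x| |y| (|x| |y| - x.y), and |x| |y| > 0 can be cancelled. *)
have := dot_ge0 (enorm y *: x - enorm x *: y).
rewrite !dotE -!enorm_sqr (dotC y) => h.
by rewrite -(ler_pM2l xy_gt0); nra.
Qed.

Lemma enormD x y : enorm (x + y) <= enorm x + enorm y.
Proof.
rewrite enorm_le ?addr_ge0 ?enorm_ge0// !dotE -!enorm_sqr (dotC y).
by have := dot_le_enorm x y; nra.
Qed.

Lemma enorm_continuous : continuous (@enorm R n).
Proof.
move=> x; apply: continuous_comp; last exact: sqrt_continuous.
apply: continuous_big => [|i _]; first exact: add_continuous.
move=> y; apply: (@continuous_comp _ _ _ (fun x : 'rV[R]_n => x ord0 i)
  (fun t => t ^+ 2)); first exact: coord_continuous.
exact: exprn_continuous.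
Qed.

Lemma ediam_ecball_le a r : 0 <= r -> ediam (ecball a r) <= 2 * r.
Proof.
move=> r0; apply: ge_sup.
  exists (enorm (a - a)); exists (a, a) => //.
  by split; rewrite /ecball/= enorm_le// subrr -(scale0r 0) dotZl mul0r sqr_ge0.
move=> _ [[x y] [/= xa ya] <-].
rewrite -[x - y](subrKA a) (le_trans (enormD _ _))//.
by rewrite -(enormN (a - y)) opprB mulr_natl mulr2n lerD.
Qed.

(** The point dividing the segment from [a] to [b] in the ratio r : s lies in both balls. *)
Lemma ecball_meet a b r s : 0 < r -> 0 < s ->
  dot (a - b) (a - b) <= (r + s) ^+ 2 -> ecball a r `&` ecball b s !=set0.
Proof.
move=> r0 s0; have rs_gt0 : 0 < r + s by rewrite addr_gt0.
have [r_ge0 s_ge0 rs_ge0] := And3 (ltW r0) (ltW s0) (ltW rs_gt0).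
rewrite -enorm_le// => ab.
exists (a + (r / (r + s)) *: (b - a)); rewrite /ecball; split => /=.
  rewrite addrC addKr enormZ ?divr_ge0// -enormN opprB.
  by rewrite mulrAC ler_pdivrMr// ler_wpM2l.
have -> : a + (r / (r + s)) *: (b - a) - b = (s / (r + s)) *: (a - b).
  apply/rowP => i; rewrite !mxE; field; exact: lt0r_neq0.
by rewrite enormZ ?divr_ge0// mulrAC ler_pdivrMr// ler_wpM2l.
Qed.

Lemma ecball_sub_disc a p r : sphere p -> 0 < r ->
  (ecball a r)° `<=` disc -> enorm a + r <= 1.
Proof.
move=> p1 r0 sub.
(* By continuity of [enorm], the open Euclidean ball is open in the library topology, hence inside
   the interior of the closed ball. *)
have inball y : enorm (y - a) < r -> enorm y < 1.
  move=> ya; apply: sub; rewrite /interior.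
  apply: filterS (_ : nbhs y [set x | enorm (x - a) < r]) => [x /ltW//|].
  apply: open_nbhs_nbhs; split => //.
  rewrite (_ : [set x | _] = (fun x => enorm (x - a)) @^-1` [set t | t < r])//.
  apply: open_comp; last exact: open_lt.
  move=> x _; apply: (@continuous_comp _ _ _ (fun x => x - a) enorm).
    by apply: continuousB; [exact: cvg_id|exact: cst_continuous].
  exact: enorm_continuous.
(* For s < r the point a + s u of the ball has norm |a| + s. *)
have [u u1 au] : exists2 u, enorm u = 1 & a = enorm a *: u.
  have [a0|a0] := eqVneq (enorm a) 0.
    (* At a = 0 any direction works; [p] supplies a unit vector. *)
    exists p => //; rewrite a0 scale0r; apply: dot_eq0.
    by rewrite -enorm_sqr a0 expr0n.
  exists ((enorm a)^-1 *: a); first by rewrite enormZ ?invr_ge0 ?enorm_ge0// mulVf.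
  by rewrite scalerA divff// scale1r.
apply/ler_addgt0Pr => e e0.
(* If e > r, the radius r - e is negative, but |a| < 1 is already enough. *)
case: (leP e r) => er; last first.
  have := inball a; rewrite subrr -(scale0r 0) enormZ// mul0r => /(_ r0).
  by lra.
have := inball (a + (r - e) *: u).
have a_ge0 := enorm_ge0 a; have re : 0 <= r - e by rewrite subr_ge0.
rewrite (addrC a) addrK {1}au -scalerDl !enormZ ?(addr_ge0 re)// u1 !mulr1.
by rewrite gtrBl => /(_ e0); lra.
Qed.

(** Equality case of 1 = |p| <= |a| + |p - a| <= (1 - r) + r. *)
Lemma horoball_center a p r : enorm p = 1 -> 0 < r -> enorm a + r <= 1 ->
  ecball a r p -> a = (1 - r) *: p.
Proof.
move=> p1 r0 ar; rewrite /ecball/= enorm_le; last exact: ltW.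
move=> pa.
apply/eqP; rewrite -subr_eq0; apply/eqP/dot_eq0/eqP.
rewrite eq_le dot_ge0 andbT; move: pa; rewrite !dotE (dotC p a) -!enorm_sqr p1.
have a_ge0 := enorm_ge0 a => pa.
have r1 : 0 <= 1 - r by lra.
(* |a - (1 - r) p|^2 is exactly the left side of [h1] minus the right side of [h2]. The first uses
   |p - a| <= r, the second |a| <= 1 - r. *)
have h1 : (1 - r) * (1 - 2 * dot a p + enorm a ^+ 2 - r ^+ 2) <= 0.
  by rewrite mulr_ge0_le0//; lra.
have h2 : 0 <= r * ((1 - r - enorm a) * (1 - r + enorm a)).
  by rewrite !mulr_ge0//; lra.
lra.
Qed.

End Euclidean.

Lemma horoball_atP {R : realType} {d : nat} (p : 'rV[R]_d.+1) A :
  sphere p -> horoball_at p A ->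
  exists2 r : R, 0 < r <= 1 & A = ecball ((1 - r) *: p) r.
Proof.
move=> p1 [a [r r0 [-> sub Ap]]].
have ar := ecball_sub_disc a p r p1 r0 sub.
have [pa _] : (ecball a r `&` sphere) p by rewrite Ap.
exists r; first by rewrite r0/=; have := enorm_ge0 a; lra.
by rewrite -(horoball_center a p r).
Qed.

Lemma horoballs_meet {R : realType} {n : nat} (p q : 'rV[R]_n) (r s : R) :
  enorm p = 1 -> enorm q = 1 -> 0 < r <= 1 -> 0 < s <= 1 ->
  enorm (p - q) ^+ 2 <= 4 * r * s ->
  ecball ((1 - r) *: p) r `&` ecball ((1 - s) *: q) s !=set0.
Proof.
move=> p1 q1 /andP[r0 r1] /andP[s0 s1] pq; apply: ecball_meet => //.
move: pq; rewrite enorm_sqr !dotE (dotC q p) -!enorm_sqr p1 q1 => pq.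
have pq_le1 : dot p q <= 1.
  by have := dot_le_enorm p q; rewrite p1 q1 mulr1.
(* |(1 - r) p - (1 - s) q|^2 = (r - s)^2 + (1 - r) (1 - s) |p - q|^2 *)
have : (1 - r) * (1 - s) * (1 - dot p q) <= 1 - dot p q.
  rewrite ler_piMl ?subr_ge0// mulr_ile1 ?subr_ge0//; lra.
(* Since |p - q|^2 = 2 (1 - p.q) <= 4 r s, the squared distance of the centres is at most (r - s)^2
   + 4 r s = (r + s)^2. *)
nra.
Qed.

Theorem theorem2p4 (R : realType) (d : nat) (d_ge1 : (1 <= d)%N)
    (Gamma : set ('rV[R]_d.+1 -> 'rV[R]_d.+1))
    (Gamma_kleinian : kleinian Gamma)
    (Gamma_nonelem : non_elementary Gamma)
    (Gamma_gf : geometrically_finite Gamma)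
    (Gamma_parabolic : exists2 g, Gamma g & parabolic g)
    (H : 'rV[R]_d.+1 -> set 'rV[R]_d.+1)
    (H_standard : standard_horoballs Gamma H)
    (lambda c : R) (z : 'rV[R]_d.+1) (rho : R)
    (lambda_gt1 : 1 < lambda) (lambda_le2 : lambda <= 2)
    (c_ge1 : 1 <= c)
    (z_limit : limit_set Gamma z)
    (rho_gt0 : 0 < rho)
    (p0_exists : exists2 p0, parabolic_points Gamma p0 &
      c * ediam (H p0) * rho `^ lambda >=
        c ^+ 2 * rho `^ (2 * lambda) + (enorm (z - p0) + rho) ^+ 2) :
  ([set p | (parabolic_points Gamma `&` ecball z rho) p /\
            c * rho `^ lambda <= ediam (H p)] #<= `I_1)%card.
Proof.
have [p0 Pp0 hp0] := p0_exists.
have [Hball Hdisj _ _] := H_standard.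
suff sub : [set p | (parabolic_points Gamma `&` ecball z rho) p /\
    c * rho `^ lambda <= ediam (H p)] `<=` [set p0].
  by rewrite -(card_le_eqr (@card_set1 _ p0)); exact: subset_card_le sub.
move=> p [[Pp zp] hp] /=.
have [s0 s0_int Hs0] := horoball_atP p0 _ Pp0.1 (Hball _ Pp0).
have [s s_int Hs] := horoball_atP p _ Pp.1 (Hball _ Pp).
apply: Hdisj => //; rewrite Hs Hs0; apply: horoballs_meet => //.
  exact: Pp.1.
  exact: Pp0.1.
have [/andP[s0_gt0 _] /andP[s_gt0 _]] := (s0_int, s_int).
set t := c * rho `^ lambda in hp.
have t_gt0 : 0 < t by rewrite mulr_gt0 ?powR_gt0//; lra.
(* Upper bounds on both diameters suffice: [t] bounds one from below, and the hypothesis on [p0]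
   grows with the other. *)
have ts : t <= 2 * s.
  by rewrite (le_trans hp)// Hs ediam_ecball_le// ltW.
have Hs0_le : ediam (H p0) <= 2 * s0 by rewrite Hs0 ediam_ecball_le// ltW.
have pp0 : enorm (p - p0) ^+ 2 <= (enorm (z - p0) + rho) ^+ 2.
  rewrite ler_pXn2r ?nnegrE ?enorm_ge0 ?addr_ge0 ?enorm_ge0 ?(ltW rho_gt0)//.
  by rewrite -(subrKA z) addrC (le_trans (enormD _ _))// lerD.
have t_sqr : c ^+ 2 * rho `^ (2 * lambda) = t ^+ 2.
  by rewrite (mulrC 2) powRrM powR_mulrn ?powR_ge0// exprMn.
move: hp0; rewrite t_sqr mulrAC -/t => hp0.
(* |p - p0|^2 <= t |H_{p0}| - t^2 <= 2 t s0 <= 4 s s0. *)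
nra.
Qed.
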